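(* Let $\mathbb{K}$ be a field and let $C=\bigoplus_{j\ge 0}C_j$ be a graded $\mathbb{K}$-algebra with $\dim_{\mathbb{K}}C_j=N<\infty$ for all $j$, and $C_j=\sum_{i=1}^{N}\mathbb{K}\cdot e_i^{[j]}$. Suppose that for every $t$ with $1\le t\le N$ and all $i,j\in\mathbb{N}$ there exist $1\le r,s\le N$ such that $e_t^{[i+j]}=e_r^{[i]}e_s^{[j]}$. Let $A\subset C$ be a full rank $1$ algebra. Then $A$ is a finitely generated $\mathbb{K}$-algebra.
   Context: Algebras are associative, with unit, and not necessarily commutative. Here $\mathbb{N}=\{0,1,2,\dots\}$. A full rank $1$ algebra in a graded $\mathbb{K}$-algebra $C=\bigoplus_{j\ge0}C_j$ is a subalgebra $A\subset C$ such that $A=E\oplus\bigoplus_{j=k_0}^{\infty}C_j$ for some finite dimensional $\mathbb{K}$-vector space $E$ and some $k_0\in\mathbb{N}$. *)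

(* Defs.v *)
From HB Require Import structures.
From mathcomp Require Import all_boot all_order all_algebra.
From mathcomp Require Import boolp classical_sets functions cardinality.

Set Implicit Arguments.
Unset Strict Implicit.
Unset Printing Implicit Defensive.

Import GRing.Theory.
Local Open Scope classical_set_scope.
Local Open Scope ring_scope.

(* The algebra C is infinite dimensional in general, so its
   subspaces are sets; [GRing.submod_closed] and [GRing.subalg_closed] apply to
   them through the (classical) membership predicate [in A] of a set A. *)

Definition is_subspace (K : fieldType) (U : lmodType K) (W : set U) : Prop :=
  GRing.submod_closed [in W].

(* Subalgebras contain the unit of C. *)
Definition is_subalgebra (K : fieldType) (C : algType K) (A : set C) : Prop :=
  GRing.subalg_closed [in A].

Definition lin_span (K : fieldType) (U : lmodType K) (n : nat)
    (b : 'I_n -> U) : set U :=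
  [set x | exists a : 'I_n -> K, x = \sum_(i < n) a i *: b i].

Definition lin_free (K : fieldType) (U : lmodType K) (n : nat)
    (b : 'I_n -> U) : Prop :=
  forall a : 'I_n -> K, \sum_(i < n) a i *: b i = 0 -> forall i, a i = 0.

Definition has_dim (K : fieldType) (U : lmodType K) (W : set U) (n : nat)
    : Prop :=
  exists b : 'I_n -> U, lin_free b /\ W = lin_span b.

Definition finite_dim (K : fieldType) (U : lmodType K) (W : set U) : Prop :=
  exists n : nat, has_dim W n.

Definition sum_from (K : fieldType) (U : lmodType K) (V : nat -> set U)
    (k : nat) : set U :=
  [set x | exists (n : nat) (c : nat -> U),
     (forall j, V j (c j)) /\ x = \sum_(k <= j < n) c j].

Definition independent (K : fieldType) (U : lmodType K) (V : nat -> set U)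
    : Prop :=
  forall (n : nat) (c : nat -> U), (forall j, V j (c j)) ->
    \sum_(0 <= j < n) c j = 0 -> forall j, (j < n)%N -> c j = 0.

(* That 1 lies in V 0 follows from these conditions. *)
Record is_grading (K : fieldType) (C : algType K) (V : nat -> set C) : Prop :=
  IsGrading {
    grading_subspace : forall j, is_subspace (V j);
    grading_total : sum_from V 0 = setT;
    grading_direct : independent V;
    grading_mul : forall i j x y, V i x -> V j y -> V (i + j)%N (x * y)
  }.

Definition direct_sum_of (K : fieldType) (U : lmodType K) (A E F : set U)
    : Prop :=
  A = [set u + v | u in E & v in F] /\ E `&` F = [set 0].

(* The complement E need not be a graded subspace. *)
Definition full_rank1 (K : fieldType) (C : algType K) (V : nat -> set C)
    (A : set C) : Prop :=
  is_subalgebra A /\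
  exists (E : set C) (k0 : nat),
    finite_dim E /\ direct_sum_of A E (sum_from V k0).

Definition finitely_generated (K : fieldType) (C : algType K) (A : set C)
    : Prop :=
  exists S : set C,
    finite_set S /\ A = smallest (@is_subalgebra K C) S.

(* Main.v *)
Require Import Defs.
From HB Require Import structures.
From mathcomp Require Import all_boot all_order all_algebra.
From mathcomp Require Import boolp classical_sets functions cardinality.

Set Implicit Arguments.
Unset Strict Implicit.
Unset Printing Implicit Defensive.

Import GRing.Theory.
Local Open Scope classical_set_scope.
Local Open Scope ring_scope.

(** Let A = E + (the sum of the V j with j >= k) with E finite dimensional.
    Applying the factorisation e (i + j) t = e i r * e j s with i = k + 1, again
    and again to the right factor, writes every spanning vector of degree at
    least k as a product of spanning vectors of degrees from k to 2k + 1
    ([factor_closed_ge]).  These are finitely many, they lie in A, and what they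
    generate contains every V j with j >= k, hence the whole tail
    ([sum_from_sub]).  A finite spanning family of E supplies the remaining
    generators. *)

Section Subspaces.
Variables (K : fieldType) (U : lmodType K).

Lemma subspace0 (W : set U) : is_subspace W -> W 0.
Proof. by case=> W0 _; apply/set_mem. Qed.

Lemma subspaceZD (W : set U) (a : K) (x y : U) :
  is_subspace W -> W x -> W y -> W (a *: x + y).
Proof. by case=> _ WL Wx Wy; apply/set_mem; apply: WL; apply/mem_set. Qed.

Lemma subspaceD (W : set U) (x y : U) :
  is_subspace W -> W x -> W y -> W (x + y).
Proof. by move=> sW Wx Wy; rewrite -[x]scale1r; apply: subspaceZD. Qed.

Lemma subspaceZ (W : set U) (a : K) (x : U) :
  is_subspace W -> W x -> W (a *: x).
Proof.
by move=> sW Wx; rewrite -[_ *: _]addr0; apply: subspaceZD => //; exact: subspace0.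
Qed.

Lemma subspace_sum (W : set U) (I : Type) (r : seq I) (P : pred I) (F : I -> U) :
  is_subspace W -> (forall i, P i -> W (F i)) -> W (\sum_(i <- r | P i) F i).
Proof.
move=> sW WF; apply: (big_ind W) => //; first exact: subspace0.
by move=> x y; apply: subspaceD.
Qed.

Lemma mem_lin_span n (b : 'I_n -> U) i : lin_span b (b i).
Proof.
exists (fun j => (j == i)%:R); rewrite (bigD1 i) //= eqxx scale1r big1 ?addr0 //.
by move=> j /negPf ->; rewrite scale0r.
Qed.

Lemma lin_span0 n (b : 'I_n -> U) : lin_span b 0.
Proof. by exists (fun=> 0); rewrite big1 // => i _; rewrite scale0r. Qed.

Lemma lin_span_sub (W : set U) n (b : 'I_n -> U) :
  is_subspace W -> (forall i, W (b i)) -> lin_span b `<=` W.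
Proof.
by move=> sW Wb _ [a ->]; apply: subspace_sum => // i _; apply: subspaceZ.
Qed.

Lemma sum_from_sub (V : nat -> set U) (W : set U) k :
  is_subspace W -> (forall j, (k <= j)%N -> V j `<=` W) -> sum_from V k `<=` W.
Proof.
move=> sW VW _ [n [c [Vc ->]]]; rewrite big_nat.
by apply: subspace_sum => // j /andP[/VW Wj _]; apply: Wj.
Qed.

Lemma sum_from0 (V : nat -> set U) k : (forall j, V j 0) -> sum_from V k 0.
Proof. by move=> V0; exists 0%N, (fun=> 0); split=> //; rewrite big1. Qed.

Lemma component_sub_sum_from (V : nat -> set U) k j :
  (forall i, V i 0) -> (k <= j)%N -> V j `<=` sum_from V k.
Proof.
move=> V0 kj x Vx; exists j.+1, (fun i => if i == j then x else 0); split.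
  by move=> i; case: eqP => [->|_].
rewrite big_nat_recr //= eqxx big_nat big1 ?add0r // => i /andP[_ ij].
by rewrite (ltn_eqF ij).
Qed.

Lemma direct_sum_subl (A E F : set U) : direct_sum_of A E F -> F 0 -> E `<=` A.
Proof. by case=> -> _ F0 x Ex; exists x => //; exists 0; rewrite ?addr0. Qed.

Lemma direct_sum_subr (A E F : set U) : direct_sum_of A E F -> E 0 -> F `<=` A.
Proof. by case=> -> _ E0 x Fx; exists 0 => //; exists x; rewrite ?add0r. Qed.

End Subspaces.

Section Subalgebras.
Variables (K : fieldType) (C : algType K).

Lemma subalgebra_subspace (B : set C) : is_subalgebra B -> is_subspace B.
Proof. by case=> B1 BL _; split=> //; rewrite -(subrr 1) addrC -scaleN1r; apply: BL. Qed.

Lemma subalgebraM (B : set C) (x y : C) :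
  is_subalgebra B -> B x -> B y -> B (x * y).
Proof. by case=> _ _ BM Bx By; apply/set_mem; apply: BM; apply/mem_set. Qed.

(** The split degree is k.+1 rather than k so that it is positive, which makes
    the complementary degree smaller; the complementary degree must in turn be
    at least k, so degrees below k.+1.*2 are left to the hypothesis. *)
Lemma factor_closed_ge (T : Type) (e : nat -> T -> C) (B : set C) (k : nat) :
    (forall t i j, exists r s, e (i + j)%N t = e i r * e j s) ->
    is_subalgebra B ->
    (forall j t, (k <= j < k.+1.*2)%N -> B (e j t)) ->
  forall j t, (k <= j)%N -> B (e j t).
Proof.
move=> e_mul sB Bsmall; elim/ltn_ind=> j IH t kj.
have [j_small|j_large] := ltnP j k.+1.*2; first by apply: Bsmall; rewrite kj.
rewrite -addnn in j_large.
have kSj : (k.+1 <= j)%N by apply: leq_trans j_large; rewrite leq_addr.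
have [r [s]] := e_mul t k.+1 (j - k.+1)%N; rewrite subnKC // => ->.
apply: subalgebraM => //.
  by apply: Bsmall; rewrite leqnSn -addnn -[X in (X < _)%N]addn0 ltn_add2l.
apply: IH; first by rewrite ltn_subrL (leq_trans _ kSj).
by rewrite leq_subRL // (leq_trans _ j_large) // leq_add2l.
Qed.

End Subalgebras.

Theorem theorem1 (K : fieldType) (C : algType K) (V : nat -> set C)
    (V_grading : is_grading V)
    (N : nat) (V_dim : forall j, has_dim (V j) N)
    (e : nat -> 'I_N -> C) (V_span : forall j, V j = lin_span (e j))
    (e_mul : forall (t : 'I_N) (i j : nat),
       exists r s : 'I_N, e (i + j)%N t = e i r * e j s)
    (A : set C) (A_full : full_rank1 V A) :
  finitely_generated A.
Proof.
have V0 j : V j 0 by apply: subspace0; exact: grading_subspace.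
case: A_full => sA [E [k [[n [b [_ E_span]]] A_sum]]].
have sub_EA : E `<=` A by apply: (direct_sum_subl A_sum); exact: sum_from0.
have sub_VA : sum_from V k `<=` A.
  by apply: (direct_sum_subr A_sum); rewrite E_span; exact: lin_span0.
pose D := [set p : 'I_(k.+1.*2) * 'I_N | (k <= p.1)%N].
exists (range b `|` [set e p.1 p.2 | p in D]); split.
  by rewrite finite_setU; split; apply: finite_image; exact: finite_finset.
apply/seteqP; split=> [x Ax B [sB SB]|]; last first.
  apply: smallest_sub => // x [[i _ <-]|[p kp <-]].
    by apply: sub_EA; rewrite E_span; exact: mem_lin_span.
  apply/sub_VA/(component_sub_sum_from V0 kp).
  by rewrite V_span; exact: mem_lin_span.
have ssB := subalgebra_subspace sB.
have Be j t : (k <= j)%N -> B (e j t).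
  apply: (factor_closed_ge e_mul sB) => {t}j t /andP[kj jk].
  by apply: SB; right; exists (Ordinal jk, t).
case: A_sum Ax => -> _ [u Eu [v Fv <-]]; apply: subspaceD => //.
  move: Eu; rewrite E_span; apply: lin_span_sub => // i.
  by apply: SB; left; exists i.
apply: sum_from_sub Fv => // j kj; rewrite V_span.
by apply: lin_span_sub => // t; apply: Be.
Qed.
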